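(* For integers $k\ge 1$ and $m\ge 1$, let $H_k^m$ be the graph on $n=7k+m$ vertices obtained by taking the disjoint union of $G=H(c^k)$ and $K=c^m$ and adding edges from each vertex in $K$ to all the $3k$ vertices of $G$ labeled $w_{7i}$, $w_{7i+1}$, $w_{7i+2}$, for $0\le i<k$. Then $H_k^m$ is ELC-preserved.
   Context: All graphs are finite, simple and undirected. For a graph $G=(V,E)$ and $v\in V$, $N_v$ is the set of vertices adjacent to $v$. Local complementation (LC) on $v$ transforms $G$ into $G*v$ by replacing the induced subgraph of $G$ on $N_v$ by its complement. For an edge $\{u,v\}\in E$, edge local complementation (ELC) on $\{u,v\}$ transforms $G$ into $G^{(u,v)}=G*u*v*u=G*v*u*v$ (operations applied from left to right). $G$ is ELC-preserved if for every edge $\{u,v\}\in E$, $G^{(u,v)}$ is isomorphic to $G$. $c^n$ denotes the complete graph on $n$ vertices. Hamming expansion: let $G=(V,E)$ with $V=\{v_0,\dots,v_{k-1}\}$. $H(G)$ is the graph on the $7k$ vertices $w_0,\dots,w_{7k-1}$ constructed as follows. For each $0\le i<k$, the vertex $v_i$ is replaced by the subgraph $h_i$ with vertices $\{w_{7i},\dots,w_{7i+6}\}$ and edges $\{w_{7i},w_{7i+3}\}$, $\{w_{7i},w_{7i+4}\}$, $\{w_{7i+1},w_{7i+3}\}$, $\{w_{7i+1},w_{7i+5}\}$, $\{w_{7i+2},w_{7i+4}\}$, $\{w_{7i+2},w_{7i+5}\}$, $\{w_{7i+3},w_{7i+6}\}$, $\{w_{7i+4},w_{7i+6}\}$, $\{w_{7i+5},w_{7i+6}\}$.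 If $\{v_i,v_j\}\in E$, each of $w_{7i},w_{7i+1},w_{7i+2}$ is joined to all of $w_{7j},w_{7j+1},w_{7j+2}$. There are no other edges. *)

(* Defs.v *)
From HB Require Import structures.
From mathcomp Require Import all_boot.

Set Implicit Arguments.
Unset Strict Implicit.
Unset Printing Implicit Defensive.

Record sgraph := SGraph {
  vertex :> finType;
  edge : rel vertex;
  edge_sym : symmetric edge;
  edge_irr : irreflexive edge }.

Definition isomorphic (G G' : sgraph) : Prop :=
  exists2 f : G -> G', bijective f & forall x y, edge (f x) (f y) = edge x y.

Section LocalComplementation.
Variables (G : sgraph) (v : G).

Definition lc_edge : rel G :=
  [rel x y | if [&& x != y, edge v x & edge v y] then ~~ edge x y
             else edge x y].

Lemma lc_edge_sym : symmetric lc_edge.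
Proof.
move=> x y; rewrite /lc_edge /= eq_sym [edge x y]edge_sym.
by rewrite [edge v x && _]andbC.
Qed.

Lemma lc_edge_irr : irreflexive lc_edge.
Proof. by move=> x; rewrite /lc_edge /= eqxx /= edge_irr. Qed.

Definition lc : sgraph := SGraph lc_edge_sym lc_edge_irr.
End LocalComplementation.

(* lc keeps the vertex type, so u and v are also vertices of the successive  *)
(* graphs G * u and G * u * v.                                               *)
Definition elc (G : sgraph) (u v : G) : sgraph :=
  @lc (@lc (@lc G u) v) u.

Lemma elcC (G : sgraph) (u v x y : G) :
  edge u v -> edge (s := elc u v) x y = edge (s := elc v u) x y.
Proof.
move=> uv.
have vu : edge v u by rewrite edge_sym.
have nuv : (u == v) = false by apply: contraTF uv => /eqP->; rewrite edge_irr.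
rewrite /=; do 3 (unfold lc_edge; simpl).
have [<-|xy] := eqVneq x y; first by rewrite /= edge_irr.
rewrite ?[_ == u]eq_sym ?[_ == v]eq_sym.
have [?|nux] := eqVneq u x; have [?|nvx] := eqVneq v x;
have [?|nuy] := eqVneq u y; have [?|nvy] := eqVneq v y; subst;
rewrite ?eqxx ?edge_irr ?uv ?vu ?nuv //= in xy *;
repeat match goal with
| |- context [edge ?a ?b] => case: (edge a b) => //=
| |- context [?a == ?b] => case: (a == b) => //=
end.
Qed.

Definition elc_preserved (G : sgraph) : Prop :=
  forall u v : G, edge u v -> isomorphic (elc u v) G.

Section Complete.
Variable n : nat.

Definition complete_edge : rel 'I_n := [rel i j | i != j].

Lemma complete_edge_sym : symmetric complete_edge.
Proof. by move=> i j; rewrite /complete_edge /= eq_sym. Qed.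

Lemma complete_edge_irr : irreflexive complete_edge.
Proof. by move=> i; rewrite /complete_edge /= eqxx. Qed.

Definition complete : sgraph := SGraph complete_edge_sym complete_edge_irr.
End Complete.

Definition block_edges : seq (nat * nat) :=
  [:: (0, 3); (0, 4); (1, 3); (1, 5); (2, 4); (2, 5); (3, 6); (4, 6); (5, 6)].

(* The vertex w_(7i+a) of H(G), with a < 7, is encoded as the pair (v_i, a). *)
Section HammingExpansion.
Variable G : sgraph.

Definition hamming_outer (w : G * 'I_7) : bool := w.2 < 3.

Definition hamming_edge : rel (G * 'I_7) :=
  fun w w' =>
    if w.1 == w'.1 then
      ((val w.2, val w'.2) \in block_edges)
        || ((val w'.2, val w.2) \in block_edges)
    else [&& edge w.1 w'.1, hamming_outer w & hamming_outer w'].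

Lemma hamming_edge_sym : symmetric hamming_edge.
Proof.
move=> w w'; rewrite /hamming_edge eq_sym orbC [edge w.1 _]edge_sym.
by rewrite [hamming_outer w && _]andbC.
Qed.

Lemma hamming_edge_irr : irreflexive hamming_edge.
Proof.
by case=> i [[|[|[|[|[|[|[|a]]]]]]] lta]; rewrite /hamming_edge /= eqxx.
Qed.

Definition hamming : sgraph := SGraph hamming_edge_sym hamming_edge_irr.
End HammingExpansion.

Section HGraph.
Variables k m : nat.

Definition Hgraph_edge : rel (hamming (complete k) + complete m) :=
  fun x y => match x, y with
  | inl w, inl w' => edge w w'
  | inr z, inr z' => edge z z'
  | inl w, inr _ | inr _, inl w => hamming_outer w
  end.

Lemma Hgraph_edge_sym : symmetric Hgraph_edge.
Proof. by case=> [w|z] [w'|z'] //; apply: (@edge_sym (_ : sgraph)). Qed.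

Lemma Hgraph_edge_irr : irreflexive Hgraph_edge.
Proof. by case=> [w|z]; apply: (@edge_irr (_ : sgraph)). Qed.

Definition Hgraph : sgraph := SGraph Hgraph_edge_sym Hgraph_edge_irr.

Lemma card_Hgraph : #|Hgraph| = 7 * k + m.
Proof. by rewrite card_sum card_prod !card_ord mulnC. Qed.
End HGraph.

(* Main.v *)
Require Import Defs.
From mathcomp Require Import all_boot.

Set Implicit Arguments.
Unset Strict Implicit.
Unset Printing Implicit Defensive.

(** Write [n_u] for the indicator function of the closed neighbourhood of [u].
    Modulo 2, ELC on an edge [uv] adds to the adjacency matrix the alternating
    matrix [n_u n_v^T + n_v n_u^T] (lemma [elc_edgeE]): it complements the
    edges between the three classes of neighbours of [u] and [v], and exchanges
    the neighbourhoods of [u] and [v].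

    The vertices of the graph split into pieces: the [k] blocks of the Hamming
    expansion and the [m] single vertices of the complete graph.  Two vertices
    of different pieces are adjacent exactly when both are outer.  Give each
    piece its own root, a new vertex adjacent to its outer vertices; the whole
    graph is recovered by deleting the roots and joining the former neighbours
    of different roots.

    In this situation ELC is a local operation.  Seen from inside a piece, the
    outer vertices of the other pieces behave like the root.  On an edge inside a
    piece, ELC acts on the rooted piece as ELC on that edge.  On an edge [uv]
    between two pieces, it acts on the piece of [u] as ELC on the edge from [u]
    to its root, likewise for [v], and leaves the other pieces alone.  So the
    graph is ELC-preserved as soon as, for each edge of each rooted piece, ELC
    on it gives back the same rooted piece up to an isomorphism that fixes the
    root ([elc_preserved_rooted_pieces]): these isomorphisms can be glued.

    It remains to inspect two rooted pieces.  A single vertex with its root is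
    one edge, on which ELC does nothing.  A Hamming block with its root is the
    graph of the 3-dimensional cube, whose ELC images are cubes again; as the
    cube is vertex-transitive, the isomorphism can be chosen to fix the root
    ([cube_rooted_elc]). *)

(** * ELC as a rank-two update of the adjacency relation *)

Section Pivot.
Variables (T : eqType) (e : rel T).

Definition closed_nbr (u x : T) : bool := (u == x) || e u x.

Definition pivot (u v : T) : rel T := fun x y =>
  e x y (+) (closed_nbr u x && closed_nbr v y)
        (+) (closed_nbr v x && closed_nbr u y).

Lemma pivotC u v x y : pivot u v x y = pivot v u x y.
Proof. by rewrite /pivot addbAC. Qed.

End Pivot.

(** The update only involves equality and adjacency, so it commutes with
    embeddings; this carries ELC of a rooted piece to ELC of a fixed model. *)
Lemma eq_in_pivot (S T : eqType) (D : {pred S}) (d : rel S) (e : rel T)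
    (h : S -> T) u v x y :
    {in D &, injective h} -> {in D &, forall a b, d a b = e (h a) (h b)} ->
    u \in D -> v \in D -> x \in D -> y \in D ->
  pivot d u v x y = pivot e (h u) (h v) (h x) (h y).
Proof.
move=> h_inj dE Du Dv Dx Dy; rewrite /pivot /closed_nbr !dE //.
by rewrite !(inj_in_eq h_inj).
Qed.

(** Closed neighbourhoods make the formula uniform.  For [x] and [y] other than
    [u] and [v], the two correction terms differ exactly when [x] and [y] are in
    different classes among the neighbours of [u] only, of [v] only, and of
    both.  For [x = u] and such a [y] they add up to
    [edge u y (+) edge v y], which replaces the neighbourhood of [u] by that
    of [v]. *)
Lemma elc_edgeE (G : sgraph) (u v x y : G) :
  edge u v -> edge (s := elc u v) x y = pivot (@edge G) u v x y.
Proof.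
move=> uv.
have vu : edge v u by rewrite edge_sym.
have nuv : (u == v) = false by apply: contraTF uv => /eqP->; rewrite edge_irr.
have nvu : (v == u) = false by rewrite eq_sym.
rewrite /pivot /closed_nbr /=; do 3 (unfold lc_edge; simpl).
have [<-|xy] := eqVneq x y.
  by rewrite /= edge_irr andbC addFb addbb.
rewrite ?[_ == u]eq_sym ?[_ == v]eq_sym.
rewrite ?[edge _ u]edge_sym ?[edge _ v]edge_sym ?edge_irr ?uv ?vu.
have [?|nux] := eqVneq u x; have [?|nvx] := eqVneq v x;
have [?|nuy] := eqVneq u y; have [?|nvy] := eqVneq v y; subst;
rewrite ?eqxx ?edge_irr ?uv ?vu ?nuv ?nvu //= in xy nuv nvu *;
repeat match goal with
| |- context [edge ?a ?b] => case: (edge a b) => //=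
| |- context [?a == ?b] => case: (a == b) => //=
end.
Qed.

(** * Graphs made of rooted pieces *)

Section RootedPieces.
Variables (G : sgraph) (T : eqType) (piece : G -> T) (outer : pred G).

(** [None] plays the root of every piece at once: the rooted pieces are glued at
    their roots, so that no type depending on the piece is needed. *)
Definition rooted_edge (p q : option G) : bool :=
  match p, q with
  | Some x, Some y => edge x y
  | Some x, None | None, Some x => outer x
  | None, None => false
  end.

Definition rooted_piece (t : T) : {pred option G} :=
  fun p => if p is Some x then piece x == t else true.

Lemma in_rooted_piece t :
  (None \in rooted_piece t)
  * (forall x, (Some x \in rooted_piece t) = (piece x == t)).
Proof. by []. Qed.

(** Inside the piece of [u], [f] is an isomorphism from the ELC image on the edge
    from [Some u] to [q] to the rooted piece itself.  That it fixes the root is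
    expressed by [omap f None = None]. *)
Definition rooted_piece_iso (u : G) (q : option G) (f : G -> G) : Prop :=
  [/\ injective f, forall x, piece (f x) = piece x &
      {in rooted_piece (piece u) &, forall x y,
        rooted_edge (omap f x) (omap f y) = pivot rooted_edge (Some u) q x y}].

Hypothesis edge_across : forall x y,
  piece x != piece y -> edge x y = outer x && outer y.

Hypothesis rooted_elc : forall u q,
    rooted_edge (Some u) q -> q \in rooted_piece (piece u) ->
  exists f, rooted_piece_iso u q f.

Lemma closed_nbr_across w x :
  piece w != piece x -> closed_nbr (@edge G) w x = outer w && outer x.
Proof.
move=> wx; rewrite /closed_nbr edge_across //.
by case: (w =P x) wx => [->|]; rewrite ?eqxx.
Qed.

(** A map that preserves the pieces is injective once it is so on each piece. *)
Lemma elc_isomorphic (u v : G) (g : G -> G) :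
    edge u v -> (forall x, piece (g x) = piece x) ->
    (forall x y, piece x = piece y -> g x = g y -> x = y) ->
    (forall x y, edge (g x) (g y) = pivot (@edge G) u v x y) ->
  isomorphic (elc u v) G.
Proof.
move=> uv gP g_inj gE; exists g; last by move=> x y; rewrite gE elc_edgeE.
by apply: injF_bij => x y gxy; apply: g_inj => //; rewrite -gP gxy gP.
Qed.

(** A vertex [y] outside the piece of [u] and [v] sees an outer vertex of that
    piece as the root does, so the adjacency of [x] and [y] after ELC is that of
    [x] and the root, cut down to the outer [y].  Two vertices [x] and [y] both
    outside receive the same correction twice. *)
Lemma elc_same_piece (u v : G) :
  edge u v -> piece u = piece v -> isomorphic (elc u v) G.
Proof.
move=> uv puv; have [|f [f_inj fP fE]] := @rooted_elc u (Some v) uv.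
  by rewrite in_rooted_piece puv.
pose g x := if piece x == piece u then f x else x.
have gP x : piece (g x) = piece x by rewrite /g; case: ifP.
(* Adjacency to the root after ELC. *)
have outer_f x : piece x = piece u ->
    outer (f x) = outer x (+) (closed_nbr (@edge G) u x && outer v)
                          (+) (closed_nbr (@edge G) v x && outer u).
  by move=> px; apply: (fE (Some x) None) => //; rewrite in_rooted_piece px.
apply: (@elc_isomorphic u v g) => // x y.
  by rewrite /g => ->; case: ifP => // _; apply: f_inj.
rewrite /g; have [px|px] := eqVneq (piece x); have [py|py] := eqVneq (piece y).
- by apply: (fE (Some x) (Some y)); rewrite in_rooted_piece ?px ?py.
- rewrite edge_across ?fP ?px 1?eq_sym // outer_f // /pivot.
  rewrite edge_across ?px 1?eq_sym // !(@closed_nbr_across _ y) -?puv 1?eq_sym //.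
  move: (closed_nbr _ u x) (closed_nbr _ v x) => a b.
  by case: (outer x) (outer y) (outer u) (outer v) a b => [] [] [] [] [] [].
- rewrite edge_across ?fP ?py // outer_f // /pivot.
  rewrite edge_across ?py // !(@closed_nbr_across _ x) -?puv 1?eq_sym //.
  move: (closed_nbr _ u y) (closed_nbr _ v y) => a b.
  by case: (outer x) (outer y) (outer u) (outer v) a b => [] [] [] [] [] [].
rewrite /pivot !closed_nbr_across -?puv 1?eq_sym //.
move: (edge x y) => e.
by case: e (outer x) (outer y) (outer u) (outer v) => [] [] [] [] [].
Qed.

(** Inside the piece of [u], the closed neighbourhood of [v] consists of the outer
    vertices, like that of the root; hence ELC on the edge from [u] to its root
    governs this piece.  After it, the neighbours of the root are the closed
    neighbours of [u], and a vertex [x] of this piece is adjacent to a [y] of the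
    piece of [v] exactly when [x] is a closed neighbour of [u] and [y] one of
    [v], because the other two terms cancel. *)
Lemma elc_across (u v : G) :
  edge u v -> piece u != piece v -> isomorphic (elc u v) G.
Proof.
move=> uv puv; have /andP[ou ov]: outer u && outer v by rewrite -edge_across.
have [//|f [f_inj fP fE]] := @rooted_elc u None ou.
have [//|f' [f'_inj f'P f'E]] := @rooted_elc v None ov.
have outer_f w h : rooted_piece_iso w None h -> outer w ->
    forall x, piece x = piece w -> outer (h x) = closed_nbr (@edge G) w x.
  move=> [_ _ hE] ow x px.
  have /= -> := hE (Some x) None; rewrite ?in_rooted_piece ?px //.
  rewrite /pivot /closed_nbr /= ow !andbT.
  by rewrite addbAC addbb.
pose g x := if piece x == piece u then f x
            else if piece x == piece v then f' x else x.
have gP x : piece (g x) = piece x by rewrite /g; do 2 case: ifP => // _.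
have outer_g x : outer (g x) =
    if piece x == piece u then closed_nbr (@edge G) u x
    else if piece x == piece v then closed_nbr (@edge G) v x else outer x.
  rewrite /g; case: eqVneq => [px|_]; first exact: (outer_f u).
  by case: eqVneq => [px|_] //; apply: (outer_f v).
apply: (@elc_isomorphic u v g) => // x y.
  rewrite /g => ->.
  by case: ifP => _; [apply: f_inj | case: ifP => // _; apply: f'_inj].
have [pxy|pxy] := eqVneq (piece x) (piece y).
- rewrite /g -pxy; case: eqVneq => [px|px].
    have /= -> := fE (Some x) (Some y); rewrite ?in_rooted_piece -?pxy ?px //.
    rewrite /pivot.
    by rewrite ![closed_nbr _ v _]closed_nbr_across -?pxy ?px 1?eq_sym // ov.
  case: eqVneq => [px'|px'].
    have /= -> := f'E (Some x) (Some y); rewrite ?in_rooted_piece -?pxy ?px' //.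
    rewrite pivotC /pivot.
    by rewrite ![closed_nbr _ u _]closed_nbr_across -?pxy ?px' // ou.
  rewrite /pivot !closed_nbr_across -?pxy 1?eq_sym // ou ov /=.
  by rewrite -addbA addbb addbF.
rewrite edge_across ?gP // !outer_g /pivot edge_across //.
have cl w z : outer w -> piece z != piece w ->
    closed_nbr (@edge G) w z = outer z.
  by move=> ow pz; rewrite closed_nbr_across 1?eq_sym // ow.
have [px|px] := eqVneq (piece x) (piece u).
  have [py|py] := eqVneq (piece y) (piece u); first by rewrite px py eqxx in pxy.
  rewrite (cl u y) // (cl v x) ?px //.
  by case: ifPn => py'; last rewrite (cl v y) //; rewrite addbAC addbb.
rewrite (cl u x) //.
have [px'|px'] := eqVneq (piece x) (piece v).
  have [py|py] := eqVneq (piece y) (piece u).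
    by rewrite (cl v y) ?py // addbb.
  have py' : piece y != piece v by rewrite eq_sym -px'.
  by rewrite (negPf py') (cl u y) // (cl v y) // addbb.
rewrite (cl v x) //.
have [py|py] := eqVneq (piece y) (piece u).
  by rewrite (cl v y) ?py // addbb.
rewrite (cl u y) //; case: ifPn => py'; first by rewrite addbAC addbb.
by rewrite (cl v y) // addbb.
Qed.

Theorem elc_preserved_rooted_pieces : elc_preserved G.
Proof.
move=> u v uv; have [/elc_same_piece|/elc_across] := eqVneq (piece u) (piece v);
exact.
Qed.

End RootedPieces.

(** * The cube *)

(** The vertices 0 to 6 are those of a Hamming block and 7 is the root.  Over the
    field with two elements, this is the cube with 7 as the origin, 0, 1, 2 as
    the standard basis, 3 = 0 + 1, 4 = 0 + 2, 5 = 1 + 2 and 6 = 0 + 1 + 2. *)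
Definition cube_edge : rel nat := fun a b =>
  let E := [:: (0, 7); (1, 7); (2, 7)] ++ block_edges in
  ((a, b) \in E) || ((b, a) \in E).

Definition transposition (a b x : nat) : nat :=
  if x == a then b else if x == b then a else x.

(** The row of [a] is the exchange of [a] with the root and of the other two
    neighbours of [a] with each other, which is an isomorphism that moves the
    root, followed by the translation of the cube by [a], which takes the root
    back.  The default value 7 of [nth] is the image of the root. *)
Definition root_edge_relabel (a : nat) : nat -> nat :=
  nth 7 (nth [::] [:: [:: 0; 3; 4; 2; 1; 6; 5];
                      [:: 3; 1; 5; 2; 6; 0; 4];
                      [:: 4; 5; 2; 6; 1; 0; 3]] a).

(** The other neighbours of [a] and those of [b] span a perfect matching of two
    edges, which ELC on [ab] replaces by the complementary matching.  The other
    two neighbours of [b] have their third neighbour in common, so exchanging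
    them restores the matching; exchanging [a] and [b] restores their
    neighbourhoods. *)
Definition inner_edge_relabel (a b : nat) : nat -> nat :=
  let N := [seq x <- iota 0 7 | cube_edge b x & x != a] in
  transposition a b \o transposition (nth 0 N 0) (nth 0 N 1).

(** An edge that avoids the root has one end [b] among 3, 4, 5; the neighbours of
    this end differ from the root, so the root is fixed. *)
Definition cube_relabel (a b : nat) : nat -> nat :=
  if b == 7 then root_edge_relabel a
  else if 3 <= b < 6 then inner_edge_relabel a b else inner_edge_relabel b a.

Lemma cube_rooted_elc a b : a < 7 -> b < 8 -> cube_edge a b ->
  let s := cube_relabel a b in
  [/\ s 7 = 7, forall x, x < 7 -> s x < 7, {in gtn 7 &, injective s} &
      {in gtn 8 &, forall x y,
        cube_edge (s x) (s y) = pivot cube_edge a b x y}].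
Proof.
move=> a7 b8 ab s.
pose good a b (s : nat -> nat) :=
  [&& s 7 == 7, all (fun x => s x < 7) (iota 0 7), uniq (mkseq s 7) &
      all (fun x => all (fun y => cube_edge (s x) (s y) ==
                                  pivot cube_edge a b x y)
                        (iota 0 8)) (iota 0 8)].
have lt n x : x < n -> x \in iota 0 n by rewrite mem_iota.
have: all (fun a => all (fun b => cube_edge a b ==> good a b (cube_relabel a b))
                        (iota 0 8)) (iota 0 7) by vm_compute.
move=> /allP/(_ a (lt _ _ a7)) /allP/(_ b (lt _ _ b8)) /implyP/(_ ab).
rewrite /good -/s.
case/and4P=> /eqP s7 /allP slt /(mkseq_uniqP s 7) s_inj /allP sE.
split=> // [x|x y]; first by move/lt/slt.
by move=> /lt/sE/allP sxE /lt/sxE/eqP.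
Qed.

(** * The pieces of the graph *)

Section HgraphPieces.
Variables k m : nat.
Local Notation H := (Hgraph k m).

Definition Hgraph_piece (x : H) : 'I_k + 'I_m :=
  match x with inl w => inl w.1 | inr z => inr z end.

Definition Hgraph_outer (x : H) : bool :=
  if x is inl w then hamming_outer w else true.

(** Only meaningful on the vertices of one Hamming block and the root. *)
Definition cube_label (p : option H) : nat :=
  if p is Some (inl w) then val w.2 else 7.

Lemma Hgraph_edge_across (x y : H) : Hgraph_piece x != Hgraph_piece y ->
  edge x y = Hgraph_outer x && Hgraph_outer y.
Proof.
case: x y => [[i a]|z] [[j b]|z'] //= ij; last by rewrite andbT.
have {}ij : i != j by apply: contra ij => /eqP->.
by rewrite /hamming_edge /= ifN // /complete_edge /= ij.
Qed.

Lemma cube_label_inj i :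
  {in rooted_piece Hgraph_piece (inl i) &, injective cube_label}.
Proof.
case=> [[[i1 a]|//]|] [[[i2 b]|//]|] //=.
- by move=> /eqP[->] /eqP[->] /val_inj->.
- by move=> _ _ a7; have := ltn_ord a; rewrite a7.
by move=> _ _ b7; have := ltn_ord b; rewrite -b7.
Qed.

Lemma rooted_block_cube i :
  {in rooted_piece Hgraph_piece (inl i) &, forall p q,
    rooted_edge Hgraph_outer p q = cube_edge (cube_label p) (cube_label q)}.
Proof.
case=> [[[i1 a]|//]|] [[[i2 b]|//]|] //=.
- move=> /eqP[->] /eqP[->]; rewrite /hamming_edge eqxx /=.
  by case: a b => [[|[|[|[|[|[|[|a]]]]]]] ?] [[|[|[|[|[|[|[|b]]]]]]] ?].
- by move=> _ _; case: a => [[|[|[|[|[|[|[|a]]]]]]] ?].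
by move=> _ _; case: b => [[|[|[|[|[|[|[|b]]]]]]] ?].
Qed.

(** A rooted block is a copy of the cube by [cube_label], so the relabelling of
    the cube is transported to it. *)
Lemma Hgraph_rooted_elc (u : H) (q : option H) :
    rooted_edge Hgraph_outer (Some u) q ->
    q \in rooted_piece Hgraph_piece (Hgraph_piece u) ->
  exists f, rooted_piece_iso Hgraph_piece Hgraph_outer u q f.
Proof.
case: u => [[i a]|z] uq /= Dq; last first.
  (* ELC on the single edge from [z] to its root: the identity works. *)
  case: q uq Dq => [[//|z'] /= zz' /eqP[zE]|_ _].
    by rewrite zE /complete_edge /= eqxx in zz'.
  exists id; split=> //= -[[//|x]|] [[//|y]|] // Dx Dy /=.
  - move: Dx Dy => /eqP[->] /eqP[->].
    by rewrite /pivot /closed_nbr /= /complete_edge /= ?eqxx.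
  - by move: Dx => /eqP[->]; rewrite /pivot /closed_nbr /= /complete_edge /= ?eqxx.
  - by move: Dy => /eqP[->]; rewrite /pivot /closed_nbr /= /complete_edge /= ?eqxx.
have Du : (Some (inl (i, a)) : option H) \in rooted_piece Hgraph_piece (inl i).
  by rewrite in_rooted_piece.
have lt8 (p : option H) : cube_label p < 8.
  by case: p => [[[j b]|//]|//] /=; apply: ltnW; rewrite ltnS.
have := uq; rewrite (rooted_block_cube Du Dq).
case/(cube_rooted_elc (ltn_ord a) (lt8 q)) => s7 slt s_inj sE.
set s := cube_relabel _ _ in s7 slt s_inj sE.
pose f (x : H) : H :=
  match x with inl w => inl (w.1, inord (s w.2)) | inr z => inr z end.
have label_f p : p \in rooted_piece Hgraph_piece (inl i) ->
    cube_label (omap f p) = s (cube_label p).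
  by case: p => [[[j b]|//]|] //= _; rewrite inordK // slt.
have fP x : Hgraph_piece (f x) = Hgraph_piece x by case: x.
have Df p : p \in rooted_piece Hgraph_piece (inl i) ->
    omap f p \in rooted_piece Hgraph_piece (inl i).
  by case: p => // x; rewrite !in_rooted_piece fP.
exists f; split=> // [|x y Dx Dy].
  case=> [[j b]|z] [[j' b']|z'] //= [-> /(congr1 val)/=].
  rewrite !inordK ?slt // => /s_inj E.
  by congr (inl (_, _)); apply/val_inj/E; apply: ltn_ord.
rewrite (rooted_block_cube (Df _ Dx) (Df _ Dy)) !label_f //.
rewrite sE ?inE ?lt8 //.
by rewrite (eq_in_pivot (@cube_label_inj i) (@rooted_block_cube i)).
Qed.

End HgraphPieces.

Theorem theorem8 (k m : nat) (hk : 1 <= k) (hm : 1 <= m) :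
  elc_preserved (Hgraph k m).
Proof.
exact: elc_preserved_rooted_pieces (@Hgraph_edge_across k m)
                                   (@Hgraph_rooted_elc k m).
Qed.
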